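(* Let $(G,\mu_G,e_G,\alpha_G)$ be a regular Hom-group, $(G^{ab},\mu',\widetilde{\alpha_G})$ its abelianization with canonical projection $\pi:G\to G^{ab}$, and let $(H,\mu_H,e_H,\alpha_H)$ be a regular abelian Hom-group. If $f:G\to H$ is a Hom-group homomorphism, then there exists a unique Hom-group homomorphism $\widetilde{f}:G^{ab}\to H$ such that $\widetilde{f}\circ\pi=f$.
   Context: A Hom-group $(G,\mu,e,\alpha)$ is a set $G$ with an element $e$, a binary operation $\mu$ (written as a product) and a map $\alpha:G\to G$ such that for all $g,h,k\in G$: (1) $\alpha(g)(hk)=(gh)\alpha(k)$; (2) $\alpha(gh)=\alpha(g)\alpha(h)$; (3) $ge=eg=\alpha(g)$ and $\alpha(e)=e$; (4) there is a map $g\mapsto g^{-1}$ with $(gh)^{-1}=h^{-1}g^{-1}$; (5) for every $g$ there is a natural number $k$ with $\alpha^k(gg^{-1})=\alpha^k(g^{-1}g)=e$. It is regular if $\alpha$ is invertible, in which case (5) becomes $gg^{-1}=g^{-1}g=e$; it is abelian if the product is commutative. A homomorphism of Hom-groups $f:(G,\mu_G,e_G,\alpha_G)\to(H,\mu_H,e_H,\alpha_H)$ is a map with $f(\mu_G(g,h))=\mu_H(f(g),f(h))$ for all $g,h$ and $f\circ\alpha_G=\alpha_H\circ f$. The commutator Hom-subgroup $N=[G,G]$ of a regular Hom-group $G$ is the Hom-subgroup (nonempty subset which is a Hom-group with the restricted structure and the same unit) generated by the elements $[g,h]=(g^{-1}h^{-1})(gh)$, $g,h\in G$; it is normal, i.e.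 $gN=Ng$ for all $g\in G$. The abelianization is the quotient Hom-group $G^{ab}=G/N=\{gN:g\in G\}$ with product $\mu'(gN,hN)=\mu(g,h)N$, unit $eN$, and twist map $\widetilde{\alpha}(gN)=\alpha(g)N$; the canonical projection is $\pi(g)=gN$. *)

(* Defs.v *)
From HB Require Import structures.
From mathcomp Require Import all_boot.
From mathcomp Require Import boolp classical_sets.
Set Implicit Arguments.
Unset Strict Implicit.
Unset Printing Implicit Defensive.

Local Open Scope classical_set_scope.

Declare Scope homgroup_scope.
Delimit Scope homgroup_scope with hg.
Local Open Scope homgroup_scope.

(* The unit and the inverse map are data; the inverse map is unique when the
   Hom-group is regular, but need not be in general. *)
HB.mixin Record isHomGroup G := {
  hmul : G -> G -> G;
  hunit : G;
  htwist : G -> G;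
  hinv : G -> G;
  hmulA : forall g h k, hmul (htwist g) (hmul h k) = hmul (hmul g h) (htwist k);
  htwistM : forall g h, htwist (hmul g h) = hmul (htwist g) (htwist h);
  hmulg1 : forall g, hmul g hunit = htwist g;
  hmul1g : forall g, hmul hunit g = htwist g;
  htwist1 : htwist hunit = hunit;
  hinvM : forall g h, hinv (hmul g h) = hmul (hinv h) (hinv g);
  hinv_iter : forall g, exists k : nat,
    iter k htwist (hmul g (hinv g)) = hunit /\
    iter k htwist (hmul (hinv g) g) = hunit
}.

#[short(type="homGroupType")]
HB.structure Definition HomGroup := { G of isHomGroup G }.

HB.mixin Record HomGroup_isRegular G of HomGroup G := {
  htwist_bij : bijective (@htwist G)
}.

#[short(type="regHomGroupType")]
HB.structure Definition RegHomGroup := { G of HomGroup_isRegular G & HomGroup G }.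

Arguments hunit {s}.

Notation "g * h" := (hmul g h) : homgroup_scope.
Notation "g ^-1" := (hinv g) : homgroup_scope.

Definition hom_abelian (G : homGroupType) : Prop :=
  forall g h : G, g * h = h * g.

Definition hom_morphism (G H : homGroupType) (f : G -> H) : Prop :=
  (forall g h, f (g * h) = f g * f h) /\ f \o htwist = htwist \o f.

(* [K] is a Hom-group for the restrictions of the product, unit and twist map
   of [G].  The axioms that do not involve the inverse are inherited from [G];
   the inverse map [i] of [K] need not be the restriction of that of [G]. *)
Definition hom_subgroup (G : homGroupType) (K : set G) : Prop :=
  [/\ K hunit,
      forall g h, K g -> K h -> K (g * h),
      forall g, K g -> K (htwist g) &
      exists i : G -> G,
        [/\ forall g, K g -> K (i g),
            forall g h, K g -> K h -> i (g * h) = i h * i g &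
            forall g, K g -> exists k : nat,
              iter k htwist (g * i g) = hunit /\
              iter k htwist (i g * g) = hunit]].

Definition hcomm (G : homGroupType) (g h : G) : G := (g^-1 * h^-1) * (g * h).

Definition commutator_subgroup (G : homGroupType) : set G :=
  smallest (@hom_subgroup G) [set hcomm p.1 p.2 | p in [set: G * G]].
Arguments commutator_subgroup : clear implicits.

Definition hlcoset (G : homGroupType) (K : set G) (g : G) : set G :=
  [set g * n | n in K].

Definition hrcoset (G : homGroupType) (K : set G) (g : G) : set G :=
  [set n * g | n in K].

Definition abelianization (G : regHomGroupType) : Type :=
  set_type (range (hlcoset (commutator_subgroup G))).

Section RegularTheory.
Variable G : regHomGroupType.
Implicit Types (g h k x y : G) (K : set G).

Lemma htwist_inj : injective (@htwist G).
Proof. exact: bij_inj htwist_bij. Qed.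

Lemma iter_htwist1 n : iter n htwist (hunit : G) = hunit.
Proof. by elim: n => //= n ->; rewrite htwist1. Qed.

Lemma iter_htwist_eq1 n x : iter n htwist x = hunit -> x = hunit.
Proof.
elim: n => //= n IH; rewrite -[X in _ = X]htwist1 => /htwist_inj; exact: IH.
Qed.

Lemma hmulgV g : g * g^-1 = hunit.
Proof. by have [k [/iter_htwist_eq1]] := hinv_iter g. Qed.

Lemma hmulVg g : g^-1 * g = hunit.
Proof. by have [k [_ /iter_htwist_eq1]] := hinv_iter g. Qed.

Lemma htwist_surj x : exists y, htwist y = x.
Proof. by have [f _ fK] := @htwist_bij G; exists (f x). Qed.

(* A regular Hom-group is a group with product [dmul], twisted by the
   automorphism [htwist]: g * h = htwist (dmul g h). *)
Definition huntwist (g : G) : G := sval (cid (htwist_surj g)).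

Lemma huntwistK : cancel huntwist htwist.
Proof. by move=> g; rewrite /huntwist; case: cid. Qed.

Lemma htwistK : cancel htwist huntwist.
Proof. by move=> g; apply: htwist_inj; rewrite huntwistK. Qed.

Definition dmul g h : G := huntwist (g * h).

Lemma hmulE g h : g * h = htwist (dmul g h).
Proof. by rewrite huntwistK. Qed.

Lemma dmulA g h k : dmul g (dmul h k) = dmul (dmul g h) k.
Proof.
do 2 apply: htwist_inj.
by rewrite -!hmulE !htwistM -!hmulE -hmulA.
Qed.

Lemma dmul1g g : dmul hunit g = g.
Proof. by rewrite /dmul hmul1g htwistK. Qed.

Lemma dmulg1 g : dmul g hunit = g.
Proof. by rewrite /dmul hmulg1 htwistK. Qed.

Lemma huntwist1 : huntwist hunit = hunit.
Proof. by rewrite -[in LHS]htwist1 htwistK. Qed.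

Lemma dmulgV g : dmul g g^-1 = hunit.
Proof. by rewrite /dmul hmulgV huntwist1. Qed.

Lemma dmulVg g : dmul g^-1 g = hunit.
Proof. by rewrite /dmul hmulVg huntwist1. Qed.

Lemma dmulKg g h : dmul g^-1 (dmul g h) = h.
Proof. by rewrite dmulA dmulVg dmul1g. Qed.

Lemma dmulKVg g h : dmul g (dmul g^-1 h) = h.
Proof. by rewrite dmulA dmulgV dmul1g. Qed.

Lemma dmulgK g h : dmul (dmul h g) g^-1 = h.
Proof. by rewrite -dmulA dmulgV dmulg1. Qed.

Lemma dmulgKV g h : dmul (dmul h g^-1) g = h.
Proof. by rewrite -dmulA dmulVg dmulg1. Qed.

Lemma dinv_uniq g h : dmul g h = hunit -> h = g^-1.
Proof. by move=> e; rewrite -[h](dmulKg g) e dmulg1. Qed.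

Lemma dmul_htwist g h : dmul (htwist g) (htwist h) = htwist (dmul g h).
Proof. by rewrite -hmulE /dmul -htwistM htwistK. Qed.

Lemma htwistV g : htwist g^-1 = (htwist g)^-1.
Proof. by apply: dinv_uniq; rewrite dmul_htwist dmulgV htwist1. Qed.

Lemma hinvK g : (g^-1)^-1 = g.
Proof. by apply/esym/dinv_uniq; rewrite dmulVg. Qed.

Lemma dinvM g h : (dmul g h)^-1 = dmul h^-1 g^-1.
Proof. by apply/esym/dinv_uniq; rewrite -dmulA dmulKVg dmulgV. Qed.

Lemma hom_subgroup_regP K : hom_subgroup K <->
  [/\ K hunit, forall g h, K g -> K h -> K (g * h) & forall g, K g -> K g^-1].
Proof.
split=> [[K1 KM Ktw [i [iK _ iP]]]|[K1 KM KV]]; split=> //.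
- move=> g Kg; have [n [/iter_htwist_eq1 e _]] := iP _ Kg.
  have <- : i g = g^-1 by apply: dinv_uniq; rewrite /dmul e huntwist1.
  exact: iK.
- by move=> g Kg; rewrite -hmulg1; apply: KM.
- by exists hinv; split=> // [g h _ _|g _]; [exact: hinvM | exact: hinv_iter].
Qed.

Local Notation N := (commutator_subgroup G).

Lemma hom_subgroup_commutator : hom_subgroup N.
Proof.
apply/hom_subgroup_regP; split.
- by move=> K [/hom_subgroup_regP[]].
- move=> g h Ng Nh K KP; have [/hom_subgroup_regP[_ KM _] _] := KP.
  by apply: KM; [exact: Ng | exact: Nh].
- move=> g Ng K KP; have [/hom_subgroup_regP[_ _ KV] _] := KP.
  by apply: KV; exact: Ng.
Qed.

Lemma commutator_unit : N hunit.
Proof. by have /hom_subgroup_regP[] := hom_subgroup_commutator. Qed.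

Lemma commutator_mul g h : N g -> N h -> N (g * h).
Proof. by have /hom_subgroup_regP[_ + _] := hom_subgroup_commutator; apply. Qed.

Lemma commutator_inv g : N g -> N g^-1.
Proof. by have /hom_subgroup_regP[_ _] := hom_subgroup_commutator; apply. Qed.

Lemma commutator_hcomm g h : N (hcomm g h).
Proof. by apply: sub_gen_smallest; exists (g, h). Qed.

Lemma commutator_twist g : N g -> N (htwist g).
Proof. by have [_ _ + _] := hom_subgroup_commutator; apply. Qed.

Lemma commutator_untwist g : N (htwist g) -> N g.
Proof.
move=> Ng; rewrite -[g]htwistK.
have : N `<=` [set x | N (huntwist x)]; last exact.
apply: smallest_sub.
  apply/hom_subgroup_regP; split=> /= [|x y Nx Ny|x Nx].
  - rewrite huntwist1; exact: commutator_unit.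
  - rewrite -(huntwistK x) -(huntwistK y) -htwistM htwistK.
    exact: commutator_mul.
  - rewrite -(huntwistK x) -htwistV htwistK; exact: commutator_inv.
move=> _ [[x y] _ <-] /=.
rewrite -(huntwistK x) -(huntwistK y) /hcomm -!htwistV -!htwistM htwistK.
exact: commutator_hcomm.
Qed.

Lemma commutator_dmul g h : N g -> N h -> N (dmul g h).
Proof.
by move=> Ng Nh; apply: commutator_untwist; rewrite -hmulE; apply: commutator_mul.
Qed.

Lemma commutator_dcomm g h :
  N (dmul (dmul g^-1 h^-1) (dmul g h)).
Proof.
do 2 apply: commutator_untwist.
by rewrite -hmulE htwistM -!hmulE; apply: commutator_hcomm.
Qed.

Lemma commutator_conj g n : N n -> N (dmul g^-1 (dmul n g)).
Proof.
move=> Nn; have := commutator_dmul Nn (commutator_dcomm n g).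
by rewrite !dmulA dmulgV dmul1g.
Qed.

Lemma hlcosetP g x : hlcoset N g x <-> N (dmul (htwist g)^-1 x).
Proof.
split=> [[n Nn <-]|Nx].
  rewrite hmulE -dmul_htwist dmulKg; exact: commutator_twist.
exists (huntwist (dmul (htwist g)^-1 x)).
  by apply: commutator_untwist; rewrite huntwistK.
by rewrite hmulE -dmul_htwist huntwistK dmulKVg.
Qed.

Lemma hlcoset_eqP g h : hlcoset N g = hlcoset N h <-> N (dmul g^-1 h).
Proof.
have tw x y : N (dmul x^-1 y) <-> N (dmul (htwist x)^-1 (htwist y)).
  rewrite -htwistV dmul_htwist.
  by split=> [/commutator_twist|/commutator_untwist].
split=> [e|Ngh].
  by apply: (tw g h).2; apply/hlcosetP; rewrite e; apply/hlcosetP; rewrite dmulVg;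
     exact: commutator_unit.
have tNgh : N (dmul (htwist g)^-1 (htwist h)) by exact: (tw g h).1.
apply/seteqP; split=> x /hlcosetP Nx; apply/hlcosetP.
  have := commutator_dmul (commutator_inv tNgh) Nx.
  by rewrite dinvM hinvK -dmulA dmulKVg.
by have := commutator_dmul tNgh Nx; rewrite -dmulA dmulKVg.
Qed.

Lemma commutator_normal g : hlcoset N g = hrcoset N g.
Proof.
have conj x n : N n -> N (dmul x (dmul n x^-1)).
  by move=> Nn; have := commutator_conj x^-1 Nn; rewrite hinvK.
apply/seteqP; split=> _ [n Nn <-].
  exists (dmul g (dmul n g^-1)); first exact: conj.
  by rewrite !hmulE dmulA dmulgKV.
exists (dmul g^-1 (dmul n g)); first exact: commutator_conj.
by rewrite !hmulE dmulKVg.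
Qed.

Lemma hlcoset_hmul g g' h h' :
    hlcoset N g = hlcoset N g' -> hlcoset N h = hlcoset N h' ->
  hlcoset N (g * h) = hlcoset N (g' * h').
Proof.
move=> /hlcoset_eqP Ng /hlcoset_eqP Nh; apply/hlcoset_eqP.
rewrite !hmulE -htwistV dmul_htwist; apply: commutator_twist.
have := commutator_dmul (commutator_conj h Ng) Nh.
by rewrite dinvM !dmulA dmulgK.
Qed.

Lemma hlcoset_htwist g g' :
  hlcoset N g = hlcoset N g' <-> hlcoset N (htwist g) = hlcoset N (htwist g').
Proof.
split=> /hlcoset_eqP Ng; apply/hlcoset_eqP; move: Ng;
  rewrite -htwistV dmul_htwist; [exact: commutator_twist |].
exact: commutator_untwist.
Qed.

Lemma hlcoset_hinv g g' :
  hlcoset N g = hlcoset N g' -> hlcoset N g^-1 = hlcoset N g'^-1.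
Proof.
move=> /esym/hlcoset_eqP Ng; apply/hlcoset_eqP.
by have := commutator_conj g'^-1 Ng; rewrite !hinvK dmulA dmulKVg.
Qed.

Definition abel_proj g : abelianization G :=
  SigSub (mem_range (hlcoset N) g).

Definition abel_repr (A : abelianization G) : G :=
  s2val (cid2 (set_valP A)).

Lemma abel_projE g h : abel_proj g = abel_proj h <-> hlcoset N g = hlcoset N h.
Proof. by split=> [/(congr1 val)|e]; last exact: val_inj. Qed.

Lemma abel_reprK A : abel_proj (abel_repr A) = A.
Proof. by apply: val_inj => /=; rewrite /abel_repr; case: cid2. Qed.

Lemma abel_proj_surj A : exists g, abel_proj g = A.
Proof. by exists (abel_repr A); rewrite abel_reprK. Qed.

Lemma abel_repr_hlcoset g : hlcoset N (abel_repr (abel_proj g)) = hlcoset N g.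
Proof. by apply/abel_projE; rewrite abel_reprK. Qed.

(* By [abel_projM], [abel_proj_twist] and [abel_projV] below, the following
   three operations do not depend on the chosen representatives. *)
Definition abel_mul (A B : abelianization G) : abelianization G :=
  abel_proj (abel_repr A * abel_repr B).

Definition abel_twist (A : abelianization G) : abelianization G :=
  abel_proj (htwist (abel_repr A)).

Definition abel_inv (A : abelianization G) : abelianization G :=
  abel_proj (abel_repr A)^-1.

Lemma abel_projM g h : abel_mul (abel_proj g) (abel_proj h) = abel_proj (g * h).
Proof. by apply/abel_projE/hlcoset_hmul; exact: abel_repr_hlcoset. Qed.

Lemma abel_proj_twist g : abel_twist (abel_proj g) = abel_proj (htwist g).
Proof. by apply/abel_projE; rewrite -hlcoset_htwist abel_repr_hlcoset. Qed.

Lemma abel_projV g : abel_inv (abel_proj g) = abel_proj g^-1.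
Proof. by apply/abel_projE/hlcoset_hinv; exact: abel_repr_hlcoset. Qed.

Let projE := (abel_projM, abel_proj_twist, abel_projV).

Fact abel_mulA A B C :
  abel_mul (abel_twist A) (abel_mul B C) = abel_mul (abel_mul A B) (abel_twist C).
Proof.
rewrite -[A]abel_reprK -[B]abel_reprK -[C]abel_reprK.
by rewrite !projE hmulA.
Qed.

Fact abel_twistM A B :
  abel_twist (abel_mul A B) = abel_mul (abel_twist A) (abel_twist B).
Proof. by rewrite -[A]abel_reprK -[B]abel_reprK !projE htwistM. Qed.

Fact abel_mulg1 A : abel_mul A (abel_proj hunit) = abel_twist A.
Proof. by rewrite -[A]abel_reprK !projE hmulg1. Qed.

Fact abel_mul1g A : abel_mul (abel_proj hunit) A = abel_twist A.
Proof. by rewrite -[A]abel_reprK !projE hmul1g. Qed.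

Fact abel_twist1 : abel_twist (abel_proj hunit) = abel_proj hunit.
Proof. by rewrite !projE htwist1. Qed.

Fact abel_invM A B : abel_inv (abel_mul A B) = abel_mul (abel_inv B) (abel_inv A).
Proof. by rewrite -[A]abel_reprK -[B]abel_reprK !projE hinvM. Qed.

Fact abel_inv_iter A : exists k : nat,
  iter k abel_twist (abel_mul A (abel_inv A)) = abel_proj hunit /\
  iter k abel_twist (abel_mul (abel_inv A) A) = abel_proj hunit.
Proof. by exists 0; rewrite -[A]abel_reprK !projE hmulgV hmulVg. Qed.

HB.instance Definition _ := isHomGroup.Build (abelianization G)
  abel_mulA abel_twistM abel_mulg1 abel_mul1g abel_twist1 abel_invM
  abel_inv_iter.

Fact abel_twist_bij : bijective (@htwist (abelianization G)).
Proof.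
exists (fun A => abel_proj (huntwist (abel_repr A))) => A.
  rewrite -[A]abel_reprK [htwist _]abel_proj_twist; apply/abel_projE.
  by rewrite hlcoset_htwist huntwistK abel_repr_hlcoset.
by rewrite [htwist _]abel_proj_twist huntwistK abel_reprK.
Qed.

HB.instance Definition _ :=
  HomGroup_isRegular.Build (abelianization G) abel_twist_bij.

Lemma abel_proj_morphism : hom_morphism abel_proj.
Proof.
split=> [g h|]; first by rewrite -abel_projM.
by apply/funext => g /=; rewrite -abel_proj_twist.
Qed.

Lemma abelianization_abelian : hom_abelian (abelianization G).
Proof.
move=> A B; rewrite -[A]abel_reprK -[B]abel_reprK.
rewrite -!(proj1 abel_proj_morphism); apply/abel_projE/hlcoset_eqP.
rewrite !hmulE -htwistV dmul_htwist; apply: commutator_twist.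
rewrite dinvM; exact: commutator_dcomm.
Qed.

End RegularTheory.

(* Main.v *)
Require Import Defs.
From HB Require Import structures.
From mathcomp Require Import all_boot.
From mathcomp Require Import boolp classical_sets.

(** A regular Hom-group is an ordinary group, with product [dmul], twisted by
    an automorphism, and a Hom-group homomorphism between regular Hom-groups is
    a homomorphism of these groups that commutes with the twists
    ([hom_morphism_dmul]).  It therefore preserves the unit and the inverses,
    although its definition mentions neither, so its kernel is a Hom-subgroup
    ([hom_kernel_subgroup]).  When the target is abelian this kernel contains
    every commutator, hence the whole commutator subgroup
    ([commutator_sub_kernel]); so the homomorphism is constant on the cosets
    ([hom_morphism_hlcoset]) and descends to the abelianization.  The induced
    map is unique, and is a homomorphism, because the projection is a
    surjective homomorphism. *)

Set Implicit Arguments.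
Unset Strict Implicit.
Unset Printing Implicit Defensive.

Local Open Scope classical_set_scope.
Local Open Scope homgroup_scope.

Definition hom_kernel (G H : homGroupType) (f : G -> H) : set G :=
  [set g | f g = hunit].

Lemma hom_morphism_twist (G H : homGroupType) (f : G -> H) :
  hom_morphism f -> {morph f : g / htwist g}.
Proof. by move=> [_ ftw] g; have := congr1 (@^~ g) ftw. Qed.

Lemma hom_morphism_dmul (G H : regHomGroupType) (f : G -> H) :
  hom_morphism f -> {morph f : g h / dmul g h}.
Proof.
move=> hf g h; apply: htwist_inj.
by rewrite -(hom_morphism_twist hf) -!hmulE hf.1.
Qed.

(** The image of the unit is an idempotent of the untwisted group of [H], and
    the only idempotent of a group is its unit. *)
Lemma hom_morphism_unit (G H : regHomGroupType) (f : G -> H) :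
  hom_morphism f -> f hunit = hunit.
Proof.
move=> hf; have := hom_morphism_dmul hf hunit hunit.
rewrite dmul1g => /esym idem.
by rewrite -[LHS](dmulKg (f hunit)) idem dmulVg.
Qed.

Lemma hom_morphism_inv (G H : regHomGroupType) (f : G -> H) :
  hom_morphism f -> {morph f : g / g^-1}.
Proof.
move=> hf g; apply: dinv_uniq.
by rewrite -(hom_morphism_dmul hf) dmulgV hom_morphism_unit.
Qed.

Lemma hom_kernel_subgroup (G H : regHomGroupType) (f : G -> H) :
  hom_morphism f -> hom_subgroup (hom_kernel f).
Proof.
move=> hf; apply/hom_subgroup_regP; split; rewrite /hom_kernel /=.
- exact: hom_morphism_unit.
- by move=> g h fg fh; rewrite hf.1 fg fh hmulg1 htwist1.
- move=> g fg; rewrite hom_morphism_inv // fg.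
  by apply/esym/dinv_uniq; rewrite dmul1g.
Qed.

Lemma hcomm_abelian (H : regHomGroupType) :
  hom_abelian H -> forall x y : H, hcomm x y = hunit.
Proof. by move=> abelH x y; rewrite /hcomm -hinvM [y * x]abelH hmulVg. Qed.

Lemma commutator_sub_kernel (G H : regHomGroupType) (f : G -> H) :
  hom_abelian H -> hom_morphism f -> commutator_subgroup G `<=` hom_kernel f.
Proof.
move=> abelH hf; apply: smallest_sub; first exact: hom_kernel_subgroup.
move=> _ [[x y] _ <-]; rewrite /hom_kernel /hcomm /=.
by rewrite !hf.1 !(hom_morphism_inv hf); exact: hcomm_abelian.
Qed.

Lemma hom_morphism_hlcoset (G H : regHomGroupType) (f : G -> H) (g h : G) :
    hom_abelian H -> hom_morphism f ->
  hlcoset (commutator_subgroup G) g = hlcoset (commutator_subgroup G) h ->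
  f g = f h.
Proof.
move=> abelH hf /hlcoset_eqP /(commutator_sub_kernel abelH hf) fgh.
by rewrite -[h](dmulKVg g) hom_morphism_dmul // fgh dmulg1.
Qed.

(** A map on the abelianization is a homomorphism as soon as its composite with
    the projection is, since every coset has a representative. *)
Lemma hom_morphism_abel_proj (G H : regHomGroupType)
    (u : abelianization G -> H) :
  hom_morphism (u \o @abel_proj G) -> hom_morphism u.
Proof.
have [projM _] := abel_proj_morphism G => hu; split=> [A B|].
  rewrite -[A]abel_reprK -[B]abel_reprK -projM.
  exact: hu.1.
apply/funext => A /=; rewrite -[A]abel_reprK.
rewrite -(hom_morphism_twist (abel_proj_morphism G)).
exact: (hom_morphism_twist hu).
Qed.

Theorem proposition3p19 (G H : regHomGroupType) (abelH : hom_abelian H)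
    (f : G -> H) (hf : hom_morphism f) :
  exists! ft : abelianization G -> H,
    hom_morphism ft /\ ft \o @abel_proj G = f.
Proof.
have ft_proj : (f \o @abel_repr G) \o @abel_proj G = f.
  apply/funext => g; apply: (hom_morphism_hlcoset abelH hf).
  exact: abel_repr_hlcoset.
exists (f \o @abel_repr G); split.
  by split=> //; apply: hom_morphism_abel_proj; rewrite ft_proj.
move=> u [_ u_proj]; apply/funext => A.
by rewrite -u_proj /= abel_reprK.
Qed.
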